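(* Let $b\in\mathbb{R}^n\setminus\mathbb{Z}^n$ and let $C^P$ be the corner polyhedron associated with a finite set $P\subseteq\mathbb{R}^n$. Then $C^P=G_b\cap\operatorname{aff}(C^P)$.
   Context: $\mathbb{R}^{(\mathbb{R}^n)}$ is the real vector space of functions $\mathbb{R}^n\to\mathbb{R}$ with finite support, $\mathbb{R}^{(\mathbb{R}^n)}_+$ the subset of its nonnegative functions. $M_b$ is the set of all pairs $(s,y)$ of finite-support functions $s:\mathbb{R}^n\to\mathbb{R}_+$, $y:\mathbb{R}^n\to\mathbb{Z}_+$ such that $\sum_{r} r\,s(r)+\sum_{p}p\,y(p)\in b+\mathbb{Z}^n$, and $I_b=\{y:(0,y)\in M_b\}$. For finite $P\subseteq\mathbb{R}^n$, the corner polyhedron is $C^P=\operatorname{conv}(I_b)\cap V_P$, where $V_P=\{y\in\mathbb{R}^{(\mathbb{R}^n)}:y(p)=0\ \forall p\notin P\}$ and conv is the convex hull. A tuple $(\psi,\pi,\alpha)$ with $\psi,\pi:\mathbb{R}^n\to\mathbb{R}$, $\alpha\in\{-1,0,1\}$ is a valid tuple for $M_b$ if $\sum_r\psi(r)s(r)+\sum_p\pi(p)y(p)\ge\alpha$ for all $(s,y)\in M_b$. $Q_b$ is the set of all $(s,y)\in\mathbb{R}^{(\mathbb{R}^n)}_+\times\mathbb{R}^{(\mathbb{R}^n)}_+$ satisfying $\sum_r\psi(r)s(r)+\sum_p\pi(p)y(p)\ge\alpha$ for every valid tuple $(\psi,\pi,\alpha)$ for $M_b$, and $G_b=\{y\in\mathbb{R}^{(\mathbb{R}^n)}:(0,y)\in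 Q_b\}$. $\operatorname{aff}(C)$ is the set of affine combinations of points of $C$ (so $\operatorname{aff}(\emptyset)=\emptyset$). *)

(* Defs.v *)
From HB Require Import structures.
From mathcomp Require Export all_boot all_order all_algebra.
From mathcomp Require Export boolp classical_sets functions cardinality fsbigop.
From mathcomp Require Export reals convex.

Set Implicit Arguments.
Unset Strict Implicit.
Unset Printing Implicit Defensive.

Import Order.TTheory GRing.Theory Num.Theory.
Local Open Scope classical_set_scope.
Local Open Scope ring_scope.

Definition convex_hull (R : numDomainType) (E : lmodType R) (A : set E)
  : set E := smallest (@convex_set R E) A.

(* Affine combinations have at least one term: the empty sum is 0 != 1, so the
   affine hull of the empty set is empty. *)
Definition affine_hull (R : numDomainType) (E : lmodType R) (A : set E)
  : set E :=
  [set x | exists (m : nat) (c : 'I_m -> R) (a : 'I_m -> E),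
     [/\ forall i, A (a i), \sum_(i < m) c i = 1
       & x = \sum_(i < m) c i *: a i]].

Section InfiniteModels.
Variables (R : realType) (n : nat).
Local Notation Rn := 'rV[R]_n.

(* R^o is R as a module over itself; with it the space of functions is
   recognised as an lmodType R. *)
Local Notation funRn := (Rn -> R^o).

Definition Zn : set Rn := [set z | z \is a mxOver Num.int].

(* The space R^(R^n) is the subspace fin_supp of the space of all functions
   from R^n to R; the sums below, indexed by all of R^n, are finite because one
   factor of the summand has finite support. *)
Definition fin_supp : set funRn := [set f | finite_set [set r | f r != 0]].

Definition fin_supp_ge0 : set funRn :=
  [set f | fin_supp f /\ forall r, 0 <= f r].

Definition M_ (b : Rn) : set (funRn * funRn) :=
  [set sy | [/\ fin_supp_ge0 sy.1,
       fin_supp sy.2,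
       forall p, sy.2 p \is a Num.nat
     & [set b + z | z in Zn]
         (\sum_(r \in [set: Rn]) sy.1 r *: r +
          \sum_(p \in [set: Rn]) sy.2 p *: p)]].

Definition I_ (b : Rn) : set funRn := [set y | M_ b (0, y)].

Definition V_ (P : set Rn) : set funRn :=
  [set y | fin_supp y /\ forall p, ~ P p -> y p = 0].

Definition corner_polyhedron (b : Rn) (P : set Rn) : set funRn :=
  convex_hull (I_ b) `&` V_ P.

Definition satisfies (psi pi : Rn -> R) (alpha : R)
    (sy : funRn * funRn) : Prop :=
  alpha <= \sum_(r \in [set: Rn]) psi r * sy.1 r +
           \sum_(p \in [set: Rn]) pi p * sy.2 p.

Definition valid_tuple (b : Rn) (psi pi : Rn -> R) (alpha : R) : Prop :=
  [set -1; 0; 1] alpha /\ forall sy, M_ b sy -> satisfies psi pi alpha sy.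

Definition Q_ (b : Rn) : set (funRn * funRn) :=
  [set sy | [/\ fin_supp_ge0 sy.1, fin_supp_ge0 sy.2
     & forall psi pi alpha,
         valid_tuple b psi pi alpha -> satisfies psi pi alpha sy]].

Definition G_ (b : Rn) : set funRn :=
  [set y | fin_supp y /\ Q_ b (0, y)].

End InfiniteModels.

(* Main.v *)
(** The corner polyhedron is the convex hull of the set S of points of Z_+^P
    that lie in a coset of the lattice L of integral relations modulo Z^n.  By
    Dickson's lemma S has finitely many minimal points, so conv S + R_+^P is
    finitely generated.  A nonnegative y in aff S that belongs to it is g + r
    with g in conv S and r >= 0 in the rational subspace spanned by L; such an
    r is a nonnegative combination of vectors of L in Z_+^P, hence y is in
    conv S.  Otherwise Gordan's theorem gives a > 0 with a.x >= 1 on S and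
    a.y < 1.  As a > 0, only finitely many points x of Z_+^P satisfy a.x < 1,
    and each misses the coset by a positive distance, so a is extended to a
    valid tuple by the constant 1 off P and a large multiple of the l1 norm on
    the continuous variables. *)
Require Import Defs.
From mathcomp Require Import lra ring zify.

Set Implicit Arguments.
Unset Strict Implicit.
Unset Printing Implicit Defensive.

Import Order.TTheory GRing.Theory Num.Theory.
Local Open Scope classical_set_scope.
Local Open Scope ring_scope.

(** * Convex hulls *)

Lemma convex_hull_conv (R : numDomainType) (E : lmodType R) (A : set E)
    (x y : E) (t : R) : 0 <= t -> t <= 1 ->
  convex_hull A x -> convex_hull A y ->
  convex_hull A (t *: x + (1 - t) *: y).
Proof.
move=> t0 t1 hx hy B /= [cB AB].
have /(_ x y (interval_inference.Itv01 t0 t1)) := cB.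
rewrite !inE => /(_ (hx B (conj cB AB)) (hy B (conj cB AB))).
by rewrite /conv /=.
Qed.

Lemma sub_convex_hull (R : numDomainType) (E : lmodType R) (A : set E) :
  A `<=` convex_hull A.
Proof. exact: sub_gen_smallest. Qed.

Lemma convex_hull_sub (R : numDomainType) (E : lmodType R) (A X : set E) :
  (forall x y t, 0 < t -> t < 1 -> X x -> X y -> X (t *: x + (1 - t) *: y)) ->
  A `<=` X -> convex_hull A `<=` X.
Proof.
move=> cX AX; apply: smallest_sub => //.
apply/convex_setW => x y; rewrite !inE => Xx Xy k k0 k1.
by rewrite inE; exact: cX.
Qed.

(** * Dickson's lemma and extrema of finite lists *)

(** Induction on the coordinates. A finite set that is good for the other coordinates also serves
    every point whose new coordinate is large; the finitely many remaining values of that coordinate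
    are treated one level at a time. The coordinates [u] are kept abstract so that complements can
    serve as coordinates too. *)
Lemma dickson (T I : eqType) (u : I -> T -> nat) (ps : seq I) (S : set T) :
  exists F : seq T, (forall f, f \in F -> S f) /\
    forall x, S x -> exists2 f, f \in F & forall p, p \in ps -> (u p f <= u p x)%N.
Proof.
elim: ps S => [|p ps IH] S.
  have [[x Sx]|nS] := pselect (exists x, S x).
    exists [:: x]; split=> [f|y Sy]; first by rewrite inE => /eqP ->.
    by exists x; rewrite ?inE.
  by exists [::]; split=> // x Sx; case: nS; exists x.
have [F0 [F0S F0P]] := IH S.
(* From level [N] on, every member of [F0] is also below in coordinate [p]; only the levels under
   [N] need further points. *)
pose N := (\max_(f <- F0) u p f)%N.
have [G [GS GP]] : exists G : seq T, (forall f, f \in G -> S f) /\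
    forall x, S x -> (u p x < N)%N ->
    exists2 f, f \in G & forall q, q \in p :: ps -> (u q f <= u q x)%N.
  elim: N => [|N [G [GS GP]]]; first by exists [::].
  have [H [HS HP]] := IH [set x | S x /\ u p x = N].
  exists (G ++ H); split=> [f|x Sx].
    by rewrite mem_cat => /orP[/GS //|/HS []].
  rewrite ltnS leq_eqVlt => /orP[/eqP xN|/(GP _ Sx)[f fG fP]]; last first.
    by exists f => //; rewrite mem_cat fG.
  have [f fH fP] := HP x (conj Sx xN); exists f.
    by rewrite mem_cat fH orbT.
  move=> q; rewrite inE => /orP[/eqP ->|/fP //].
  by rewrite xN (HS _ fH).2.
exists (F0 ++ G); split=> [f|x Sx].
  by rewrite mem_cat => /orP[/F0S|/GS].
have [xN|Nx] := ltnP (u p x) N.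
  by have [f fG fP] := GP x Sx xN; exists f; rewrite // mem_cat fG orbT.
have [f fF fP] := F0P x Sx; exists f; first by rewrite mem_cat fF.
move=> q; rewrite inE => /orP[/eqP ->|/fP //].
by apply: leq_trans Nx; rewrite /N; apply: (@leq_bigmax_seq _ F0 xpredT).
Qed.

Lemma seq_minP (R : realDomainType) (xs : seq R) :
  xs = [::] \/ exists2 x, x \in xs & forall y, y \in xs -> x <= y.
Proof.
elim: xs => [|x xs IH]; [by left | right].
case: IH => [->|[y yxs yP]].
  by exists x; rewrite ?inE // => y; rewrite inE => /eqP ->.
have [xy|yx] := leP x y.
  exists x; rewrite ?inE ?eqxx // => z; rewrite inE => /orP[/eqP -> //|/yP].
  exact: le_trans.
exists y; rewrite ?inE ?yxs ?orbT // => z; rewrite inE => /orP[/eqP ->|/yP //].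
exact: ltW.
Qed.

Lemma seq_maxP (R : realDomainType) (xs : seq R) :
  xs = [::] \/ exists2 x, x \in xs & forall y, y \in xs -> y <= x.
Proof.
have [/(congr1 size)|[x /mapP[y yxs ->] xP]] := seq_minP [seq - x | x <- xs].
  by rewrite size_map => /size0nil; left.
right; exists y => // z zxs.
by rewrite -lerN2; apply: xP; apply: map_f.
Qed.

(** Serves to choose the eliminated coefficient in [gordan] and, with the lower list reduced to 0, a
    small positive radius in [real_span_ge0]. *)
Lemma seq_between (R : realFieldType) (xs ys : seq R) :
  (forall x y, x \in xs -> y \in ys -> x < y) ->
  exists t, (forall x, x \in xs -> x < t) /\ (forall y, y \in ys -> t < y).
Proof.
move=> xy; have [->|[x xxs xP]] := seq_maxP xs;
  have [->|[y yys yP]] := seq_minP ys.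
- by exists 0.
- by exists (y - 1); split=> // z /yP yz; lra.
- by exists (x + 1); split=> // z /xP xz; lra.
- have lxy := xy _ _ xxs yys.
  by exists ((x + y) / 2); split=> z; [move/xP | move/yP] => ?; lra.
Qed.

(** * A theorem of the alternative for finite families of vectors *)

(** Coefficients are strictly positive and at least one generator occurs, so that a vanishing
    element is a nontrivial relation. *)
Inductive pos_cone (R : numDomainType) (E : lmodType R) (A : set E) : set E :=
| pos_cone_gen v : A v -> pos_cone A v
| pos_coneD v w : pos_cone A v -> pos_cone A w -> pos_cone A (v + w)
| pos_coneZ c v : 0 < c -> pos_cone A v -> pos_cone A (c *: v).

(* Gordan's theorem, by Fourier-Motzkin elimination of one coordinate of [a]
   at a time. *)
Lemma gordan (R : realFieldType) (I : eqType) (ps : seq I)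
    (ws : seq (I -> R^o)) : uniq ps ->
  (exists a : I -> R, forall w, w \in ws -> 0 < \sum_(p <- ps) a p * w p) \/
  (exists2 v, pos_cone [set` ws] v & forall p, p \in ps -> v p = 0).
Proof.
elim: ps ws => [|p ps IH] ws /=.
  case: ws => [|w ws] _; first by left; exists (fun=> 0).
  by right; exists w => //; apply: pos_cone_gen; rewrite /= inE eqxx.
case/andP=> pps ups.
pose Zs : seq (I -> R^o) := [seq w <- ws | w p == 0].
pose Ps : seq (I -> R^o) := [seq w <- ws | 0 < w p].
pose Ns : seq (I -> R^o) := [seq w <- ws | w p < 0].
(* For [m] in [Ps] and [n] in [Ns] both coefficients are positive and coordinate [p] cancels. *)
pose comb (m n : I -> R^o) : I -> R^o := (- n p) *: m + m p *: n.
pose ws' := Zs ++ [seq comb m n | m <- Ps, n <- Ns].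
have [[a aP]|[v vc v0]] := IH ws' ups; last first.
  right; exists v; last first.
    move=> q; rewrite inE => /orP[/eqP ->|/v0 //].
    elim: vc => [w|w1 w2 _ e1 _ e2|c w c0 _ e].
    - rewrite /= mem_cat => /orP[|/allpairsP[[m n] /= [_ _ ->]]].
        by rewrite mem_filter => /andP[/eqP].
      by rewrite /comb !fctE /GRing.scale /=; ring.
    - by rewrite fctE e1 e2 addr0.
    - by rewrite fctE e scaler0.
  elim: vc => [w|w1 w2 _ e1 _ e2|c w c0 _ e].
  - rewrite /= mem_cat => /orP[|/allpairsP[[m n] /= [mP nN ->]]].
      by rewrite mem_filter => /andP[_ wws]; exact: pos_cone_gen.
    move: mP nN; rewrite !mem_filter => /andP[m0 mws] /andP[n0 nws].
    by apply: pos_coneD; apply: pos_coneZ => //; rewrite ?oppr_gt0 //;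
      exact: pos_cone_gen.
  - exact: pos_coneD.
  - exact: pos_coneZ.
left.
pose g (w : I -> R^o) := \sum_(q <- ps) a q * w q.
(* The value [t] given to [p] must exceed the bounds coming from [Ps] and stay under those from
   [Ns]. Positivity on [comb m n] says exactly that these bounds are compatible. *)
have [|t [tP tN]] := @seq_between R [seq - g m / m p | m <- Ps]
    [seq - g n / n p | n <- Ns].
  move=> _ _ /mapP[m mP ->] /mapP[n nN ->].
  have : 0 < g (comb m n).
    apply: aP; rewrite mem_cat; apply/orP; right.
    by apply/allpairsP; exists (m, n).
  have -> : g (comb m n) = - n p * g m + m p * g n.
    rewrite /g !mulr_sumr -big_split; apply: eq_bigr => q _ /=.
    by rewrite /comb !fctE /GRing.scale /=; ring.
  move: mP nN; rewrite !mem_filter => /andP[m0 _] /andP[n0 _] h.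
  rewrite -subr_gt0.
  have -> : - g n / n p - - g m / m p =
    (- n p * g m + m p * g n) / (m p * - n p).
    by field; rewrite (gt_eqF m0) (lt_eqF n0).
  by rewrite divr_gt0 // mulr_gt0 // oppr_gt0.
exists (fun q => if q == p then t else a q) => w wws.
rewrite big_cons eqxx.
have -> : \sum_(q <- ps) (if q == p then t else a q) * w q = g w.
  apply: eq_big_seq => q qps; case: eqP => // qp.
  by rewrite -qp qps in pps.
have [w0|w0|w0] := ltgtP (w p) 0.
- have : t < - g w / w p by apply: tN; apply: map_f; rewrite mem_filter w0.
  by rewrite ltr_ndivlMr //; lra.
- have : - g w / w p < t by apply: tP; apply: map_f; rewrite mem_filter w0.
  by rewrite ltr_pdivrMr //; lra.
- rewrite w0 mulr0 add0r; apply: aP.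
  by rewrite mem_cat mem_filter w0 eqxx wws.
Qed.

(** Gordan's theorem is applied to the unit vectors and the differences [f - y]. A functional
    positive on all of them separates; a vanishing positive combination, divided by the total weight
    of the differences, exhibits a point of the hull below [y]. *)
Lemma dominated_or_separated (R : realFieldType) (I : eqType) (ps : seq I)
    (F : seq (I -> R^o)) (y : I -> R^o) : uniq ps ->
  (exists2 g, convex_hull [set` F] g & forall p, p \in ps -> g p <= y p) \/
  (exists a : I -> R, (forall p, p \in ps -> 0 < a p) /\
     forall f, f \in F ->
       \sum_(p <- ps) a p * y p < \sum_(p <- ps) a p * f p).
Proof.
move=> ups.
pose delta (p : I) : I -> R^o := fun q => (q == p)%:R.
pose shift (f : I -> R^o) : I -> R^o := f - y.
have [[a aP]|[v vc v0]] :=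
    gordan (map delta ps ++ map shift F) ups.
  right; exists a; split=> [p pps|f fF].
    have : 0 < \sum_(q <- ps) a q * delta p q.
      by apply: aP; rewrite mem_cat map_f.
    rewrite (bigD1_seq p) //= /delta eqxx mulr1 big1 ?addr0 // => q /negbTE ->.
    by rewrite mulr0.
  have : 0 < \sum_(q <- ps) a q * shift f q.
    by apply: aP; rewrite mem_cat orbC map_f.
  have -> : \sum_(q <- ps) a q * shift f q =
      \sum_(q <- ps) a q * f q - \sum_(q <- ps) a q * y q.
    by rewrite -sumrB; apply: eq_bigr => q _; rewrite -mulrBr.
  by rewrite subr_gt0.
left.
(* Invariant of the cone: either only unit vectors were used, and some entry is positive, or the
   differences used have total weight [t] and average [g - y]. The first case cannot vanish on
   [ps]. *)
have : ((forall p, p \in ps -> 0 <= v p) /\ (exists2 p, p \in ps & 0 < v p)) \/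
    (exists t g, [/\ 0 < t, convex_hull [set` F] g &
      forall p, p \in ps -> t * (g p - y p) <= v p]).
  elim: vc => [w|w1 w2 _ e1 _ e2|c w c0 _ [[w0 [p pps wp]]|[t [g [t0 hg gP]]]]].
  - rewrite /= mem_cat => /orP[/mapP[p pps ->]|/mapP[f fF ->]].
      left; split=> [q _|]; first by rewrite /delta ler0n.
      by exists p => //; rewrite /delta eqxx.
    right; exists 1, f; split=> // [|p pps]; last by rewrite mul1r.
    exact: sub_convex_hull.
  - case: e1 e2 => [[w10 [p pps wp]]|[t [g [t0 hg gP]]]];
      case=> [[w20 [p' pps' wp']]|[t' [g' [t'0 hg' gP']]]].
    + left; split=> [q qps|]; first by rewrite !fctE addr_ge0 ?w10 ?w20.
      by exists p; rewrite // !fctE ltr_wpDr ?w20.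
    + right; exists t', g'; split=> // q qps.
      by rewrite !fctE (le_trans (gP' _ qps)) // lerDr w10.
    + right; exists t, g; split=> // q qps.
      by rewrite !fctE (le_trans (gP _ qps)) // lerDl w20.
    + have tt0 : 0 < t + t' by rewrite addr_gt0.
      right; exists (t + t').
      exists ((t / (t + t')) *: g + (1 - t / (t + t')) *: g').
      split=> // [|q qps].
        apply: convex_hull_conv => //; first by rewrite divr_ge0 // ltW.
        by rewrite ler_pdivrMr // mul1r lerDl ltW.
      have -> : (t + t') * (((t / (t + t')) *: g + (1 - t / (t + t')) *: g') q
          - y q) = t * (g q - y q) + t' * (g' q - y q).
        rewrite !fctE /GRing.scale /=; field.
        by rewrite gt_eqF.
      by rewrite !fctE lerD ?gP ?gP'.
  - left; split=> [q qps|]; first by apply: mulr_ge0; [exact: ltW | exact: w0].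
    by exists p => //; exact: mulr_gt0.
  - right; exists (c * t), g; split=> // [|p pps]; first by rewrite mulr_gt0.
    by rewrite fctE -mulrA ler_pM2l // gP.
case=> [[_ [p /v0 ->]]|[t [g [t0 hg gP]]]]; first by rewrite ltxx.
exists g => // p pps; have := gP p pps; rewrite v0 //.
by rewrite pmulr_rle0 // subr_le0.
Qed.

(** * Real spans of integral lattices *)

(** Combinations are built one term at a time, so that an induction can alter a single real
    coefficient. *)
Inductive real_span (R : pzRingType) (E : lmodType R) (L : set E) : set E :=
| real_span0 : real_span L 0
| real_span_cons c l v : L l -> real_span L v -> real_span L (c *: l + v).

Section RealSpan.
Variables (R : pzRingType) (E : lmodType R).
Implicit Types (L : set E) (v w : E).

Lemma real_spanS L1 L2 : L1 `<=` L2 -> real_span L1 `<=` real_span L2.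
Proof.
move=> sL v; elim=> [|c l w lL _]; first exact: real_span0.
by apply: real_span_cons; exact: sL.
Qed.

Lemma real_spanD L v w : real_span L v -> real_span L w -> real_span L (v + w).
Proof.
move=> + Lw; elim=> [|c l u lL _ IH]; first by rewrite add0r.
by rewrite -addrA; exact: real_span_cons.
Qed.

Lemma real_spanZ L c v : real_span L v -> real_span L (c *: v).
Proof.
elim=> [|d l u lL _ IH]; first by rewrite scaler0; exact: real_span0.
by rewrite scalerDr scalerA; exact: real_span_cons.
Qed.

Lemma real_span_gen L v : L v -> real_span L v.
Proof.
by move=> Lv; rewrite -[v]scale1r -[_ *: _]addr0; apply: real_span_cons => //;
  exact: real_span0.
Qed.

End RealSpan.

Definition int_closed (R : pzRingType) (E : lmodType R) (L : set E) :=
  forall x y (m k : int), L x -> L y -> L (m%:~R *: x + k%:~R *: y).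

Section IntegralLattice.
Variables (R : archiRealFieldType) (I : eqType).
Implicit Types (L S X : set (I -> R^o)) (r : I -> R^o).

Lemma real_span_vanish1 L r p : int_closed L ->
  (forall l, L l -> l p \is a Num.int) -> real_span L r -> r p = 0 ->
  real_span (L `&` [set l | l p = 0]) r.
Proof.
move=> Lc Li Lr rp0.
have [[l0 [Ll0 l0p]]|nL] := pselect (exists l0, L l0 /\ l0 p != 0); last first.
  apply: real_spanS Lr => l Ll; split=> //=.
  by apply: contra_notP nL => /eqP lp; exists l.
(* Eliminating the coordinate [p] with [l0] keeps the generators in [L]. *)
suff : real_span (L `&` [set l | l p = 0]) (l0 p *: r - r p *: l0).
  rewrite rp0 scale0r subr0 => /(real_spanZ (l0 p)^-1).
  by rewrite scalerA mulVf // scale1r.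
elim: Lr {rp0} => [|c l v Ll _ IH].
  have -> : l0 p *: (0 : I -> R^o) - (0 : I -> R^o) p *: l0 = 0.
    by rewrite scaler0 scale0r subrr.
  exact: real_span0.
have -> : l0 p *: (c *: l + v) - (c *: l + v) p *: l0 =
    c *: (l0 p *: l - l p *: l0) + (l0 p *: v - v p *: l0).
  apply/funext => q; rewrite !fctE /GRing.scale /=; ring.
apply: real_span_cons => //; split=> /=; last first.
  by rewrite !fctE /GRing.scale /=; ring.
have /intrP[m ->] := Li _ Ll0; have /intrP[k ->] := Li _ Ll.
rewrite -scaleNr -mulrNz; exact: Lc.
Qed.

(** With generators that vanish wherever [r] does, small changes of the coefficients keep a
    nonnegative [r] nonnegative. *)
Lemma real_span_vanish L r (qs : seq I) : int_closed L ->
  (forall l p, L l -> l p \is a Num.int) -> real_span L r ->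
  (forall q, q \in qs -> r q = 0) ->
  real_span (L `&` [set l | forall q, q \in qs -> l q = 0]) r.
Proof.
move=> Lc Li Lr; elim: qs => [|q qs IH] rq.
  by apply: real_spanS Lr => l Ll.
have {}IH : real_span (L `&` [set l | forall q, q \in qs -> l q = 0]) r.
  by apply: IH => p pq; apply: rq; rewrite inE pq orbT.
have : real_span ((L `&` [set l | forall q, q \in qs -> l q = 0])
    `&` [set l | l q = 0]) r.
  apply: real_span_vanish1 => //; last by rewrite rq // inE eqxx.
    move=> x y m k [Lx x0] [Ly y0]; split; first exact: Lc.
    by move=> p pq /=; rewrite !fctE x0 ?y0 // !scaler0 addr0.
  by move=> l [Ll _]; exact: Li.
apply: real_spanS => l [[Ll l0] lq]; split=> // p.
by rewrite inE => /orP[/eqP ->|/l0].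
Qed.

(* A nonnegative vector of a rational subspace is a convex combination of
   nonnegative rational vectors: each real coefficient is squeezed between two
   nearby rationals, without leaving the support of [r]. *)
Lemma real_span_ge0 L X r (ps : seq I) : int_closed L -> L 0 ->
  (forall l p, L l -> l p \is a Num.int) ->
  (forall l p, L l -> p \notin ps -> l p = 0) ->
  (forall x y t, 0 < t -> t < 1 -> X x -> X y -> X (t *: x + (1 - t) *: y)) ->
  (forall l t, L l -> (forall p, 0 <= l p) -> 0 <= t -> X (t *: l)) ->
  real_span L r -> (forall p, 0 <= r p) -> X r.
Proof.
move=> Lc L0 Li Ls Xc XL Lr r0.
(* [T] is the support of [r]; members of [L'] vanish off [T], so signs matter only there. *)
pose qs := [seq p <- ps | r p == 0]; pose T := [seq p <- ps | r p != 0].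
pose L' := L `&` [set l | forall q, q \in qs -> l q = 0].
have L'c : int_closed L'.
  move=> x y m k [Lx x0] [Ly y0]; split; first exact: Lc.
  by move=> p pq /=; rewrite !fctE x0 ?y0 // !scaler0 addr0.
have L'0 l p : L' l -> p \notin T -> l p = 0.
  move=> [Ll l0]; rewrite mem_filter negb_and negbK => /orP[rp|]; last exact: Ls.
  have [pps|/Ls] := boolP (p \in ps); last exact.
  by apply: l0; rewrite mem_filter rp.
have L'r : real_span L' r.
  by apply: real_span_vanish => // q; rewrite mem_filter => /andP[/eqP].
have rT p : p \in T -> 0 < r p.
  by rewrite mem_filter lt_def r0 andbT => /andP[].
(* [q] collects the terms whose coefficients are already rational, with common denominator [N]; [v]
   holds the terms still to be treated. *)
suff main v : real_span L' v -> forall (q : I -> R^o) (N : int), 0 < N ->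
    L' (N%:~R *: q) -> (forall p, p \in T -> 0 < (q + v) p) -> X (q + v).
  rewrite -[r]add0r; apply: (main _ L'r 0 1) => // [|p /rT].
    by rewrite scaler0; split.
  by rewrite add0r.
elim=> [|c l {}v Ll Lv IH] q N N0 Lq qv0.
  have N0' : (N%:~R : R) != 0 by rewrite intr_eq0 gt_eqF.
  have -> : q + 0 = N%:~R^-1 *: (N%:~R *: q).
    by rewrite addr0 scalerA mulVf // scale1r.
  apply: XL; first by case: Lq.
    move=> p; have [/qv0|/(L'0 _ _ Lq) -> //] := boolP (p \in T).
    rewrite addr0 => qp; rewrite fctE mulr_ge0 // ?ler0z ltW //.
  by rewrite invr_ge0 ler0z ltW.
pose w : I -> R^o := q + (c *: l + v).
(* Moving the coefficient of [l] by less than [e] keeps every entry on [T] positive; the added 1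
   covers the entries where [l] vanishes. *)
have [|e [e0 eP]] := @seq_between R [:: 0] [seq w p / (`|l p| + 1) | p <- T].
  move=> x y; rewrite inE => /eqP -> /mapP[p pT ->].
  have wp0 : 0 < w p := qv0 p pT.
  by rewrite divr_gt0 // ltr_wpDl.
have {e0} e0 : 0 < e by apply: e0; rewrite inE.
have perturb d : `|ratr d - c| < e -> X (w + (ratr d - c) *: l).
  move=> dc.
  have -> : w + (ratr d - c) *: l = (q + ratr d *: l) + v.
    apply/funext => p; rewrite /w !fctE /GRing.scale /=; ring.
  apply: (IH _ (N * denq d)); first by rewrite mulr_gt0 ?denq_gt0.
    have -> : (N * denq d)%:~R *: (q + ratr d *: l) =
        (denq d)%:~R *: (N%:~R *: q) + (N * numq d)%:~R *: l.
      apply/funext => p; rewrite !fctE /GRing.scale /= !intrM /ratr.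
      by field; rewrite intr_eq0 denq_neq0.
    exact: L'c.
  move=> p pT.
  have -> : (q + ratr d *: l + v) p = w p + (ratr d - c) * l p.
    rewrite /w !fctE /GRing.scale /=; ring.
  have : e < w p / (`|l p| + 1) by apply: eP; apply: map_f.
  have lp : 0 < `|l p| + 1 by rewrite ltr_wpDl.
  rewrite ltr_pdivlMr // => h.
  have : `|(ratr d - c) * l p| <= e * `|l p|.
    by rewrite normrM ler_wpM2r // ltW.
  by rewrite ler_norml => /andP[h1 _]; lra.
have [d1] : exists d, ratr d \in `]c - e, c[ by apply: rat_in_itvoo; lra.
rewrite in_itv /= => /andP[d1e d1c].
have [d2] : exists d, ratr d \in `]c, c + e[ by apply: rat_in_itvoo; lra.
rewrite in_itv /= => /andP[d2c d2e].
have dd : 0 < ratr d2 - ratr d1 :> R by lra.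
(* Chosen so that [c] is the combination of [ratr d2] and [ratr d1] with weights [t] and [1 - t]. *)
pose t : R := (c - ratr d1) / (ratr d2 - ratr d1).
have -> : q + (c *: l + v) = t *: (w + (ratr d2 - c) *: l) +
    (1 - t) *: (w + (ratr d1 - c) *: l).
  apply/funext => p; rewrite -/w !fctE /GRing.scale /= /t; field.
  by rewrite gt_eqF.
apply: Xc.
- by rewrite divr_gt0 // subr_gt0.
- by rewrite ltr_pdivrMr // mul1r; lra.
- by apply: perturb; rewrite ltr_norml; lra.
- by apply: perturb; rewrite ltr_norml; lra.
Qed.

(** The vectors by which the hull of [S] can be translated into itself form a convex set [X]. It
    contains the nonnegative multiples of nonnegative lattice vectors, hence [y - g] by
    [real_span_ge0]. *)
Lemma convex_hull_lattice_up L S g y (ps : seq I) : int_closed L -> L 0 ->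
  (forall l p, L l -> l p \is a Num.int) ->
  (forall l p, L l -> p \notin ps -> l p = 0) ->
  (forall s l, S s -> L l -> (forall p, 0 <= l p) -> S (s + l)) ->
  convex_hull S g -> real_span L (y - g) -> (forall p, g p <= y p) ->
  convex_hull S y.
Proof.
move=> Lc L0 Li Ls SL hg Lyg gy.
pose X r := forall h, convex_hull S h -> convex_hull S (h + r).
suff : X (y - g) by move=> /(_ _ hg); rewrite addrC subrK.
apply: (real_span_ge0 (L := L) (X := X) (ps := ps)) => //; last first.
- by move=> p; rewrite !fctE subr_ge0.
- move=> l t Ll l0 t0.
  have [->|tn0] := eqVneq t 0.
    by move=> h hh; rewrite scale0r addr0.
  apply: (@convex_hull_sub _ _ _ [set h | convex_hull S (h + t *: l)])
    => /= [h1 h2 c c0 c1 X1 X2|s Ss /=].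
    have -> : c *: h1 + (1 - c) *: h2 + t *: l =
      c *: (h1 + t *: l) + (1 - c) *: (h2 + t *: l).
      by apply/funext => p; rewrite !fctE /GRing.scale /=; ring.
    by apply: convex_hull_conv => //; exact: ltW.
  (* An integer beyond [t] places [s + t *: l] on the segment between the points [s] and
     [s + k%:R *: l] of [S]; the successor makes [k] positive. *)
  pose k := (Num.truncn t).+1.
  have tk : t < k%:R by exact: truncnS_gt.
  have k0 : 0 < k%:R :> R by rewrite ltr0n.
  have -> : s + t *: l = (t / k%:R) *: (s + k%:R *: l) + (1 - t / k%:R) *: s.
    apply/funext => p; rewrite !fctE /GRing.scale /=; field.
    by rewrite gt_eqF.
  apply: convex_hull_conv; rewrite ?divr_ge0 ?ler_pdivrMr ?mul1r ?(ltW tk) //.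
    apply: sub_convex_hull; apply: SL => // [|p].
      by have := Lc _ _ k%:Z 0 Ll L0; rewrite scaler0 addr0.
    by apply: mulr_ge0; rewrite ?ler0n.
  exact: sub_convex_hull.
- move=> r1 r2 c c0 c1 X1 X2 h hh.
  have -> : h + (c *: r1 + (1 - c) *: r2) =
      c *: (h + r1) + (1 - c) *: (h + r2).
    by apply/funext => p; rewrite !fctE /GRing.scale /=; ring.
  by apply: convex_hull_conv; rewrite ?ltW //; [exact: X1 | exact: X2].
Qed.

End IntegralLattice.

(** * Hulls inside a translate of a span *)

Lemma convex_hull_real_span (R : numDomainType) (E : lmodType R) (L S : set E)
    (s0 : E) : (forall s, S s -> L (s - s0)) ->
  forall x, convex_hull S x -> real_span L (x - s0).
Proof.
move=> SL; apply: (@convex_hull_sub _ _ _ [set x | real_span L (x - s0)])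
  => /= [x y t _ _ Lx Ly|s Ss /=]; last first.
  by apply: real_span_gen; exact: SL.
have -> : t *: x + (1 - t) *: y - s0 = t *: (x - s0) + (1 - t) *: (y - s0).
  have t1 : t + (1 - t) = 1 by rewrite addrC subrK.
  by rewrite !scalerBr [RHS]addrACA -opprD -[in RHS]scalerDl t1 scale1r.
by apply: real_spanD; exact: real_spanZ.
Qed.

Lemma affine_hull_real_span (R : numDomainType) (E : lmodType R) (L S : set E)
    (s0 : E) : (forall s, S s -> real_span L (s - s0)) ->
  forall x, affine_hull S x -> real_span L (x - s0).
Proof.
move=> SL x [m [c [a [Sa c1 ->]]]].
have -> : \sum_(i < m) c i *: a i - s0 = \sum_(i < m) c i *: (a i - s0).
  under [in RHS]eq_bigr do rewrite scalerBr.
  by rewrite sumrB -scaler_suml c1 scale1r.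
elim/big_ind: _ => [|u v|i _]; first exact: real_span0.
  exact: real_spanD.
by apply: real_spanZ; exact: SL.
Qed.

Lemma fsum_seqT (I : choiceType) (V : nmodType) (rs : seq I) (f : I -> V) :
  uniq rs -> (forall r, r \notin rs -> f r = 0) ->
  \sum_(r \in [set: I]) f r = \sum_(r <- rs) f r.
Proof.
move=> urs f0; rewrite [RHS]fsbig_seq //; apply/esym/fsbig_widen => // r [_].
by move=> /negP /f0.
Qed.

(** * Integral relations modulo Z^n and the points of the corner polyhedron *)

Section Lattice.
Variables (R : realType) (n : nat).
Local Notation Rn := 'rV[R]_n.
Local Notation funRn := (Rn -> R^o).
Implicit Types (b v z : Rn) (ps rs : seq Rn) (y s : funRn).

Lemma fin_suppP s : fin_supp s <-> exists rs, forall r, r \notin rs -> s r = 0.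
Proof.
split=> [/finite_seqP[rs rsE]|[rs rs0]].
  exists rs => r; apply: contraNeq => sr.
  have : [set` rs] r by rewrite -rsE.
  by [].
apply: (@sub_finite_set _ _ [set` rs]) => [r /= |]; last exact: finite_seq.
by apply: contraNT => /rs0 ->.
Qed.

Definition l1 v : R := \sum_i `|v 0 i|.

Lemma l1_ge0 v : 0 <= l1 v.
Proof. by apply: sumr_ge0. Qed.

Lemma l1N v : l1 (- v) = l1 v.
Proof. by apply: eq_bigr => i _; rewrite mxE normrN. Qed.

(** The continuous variables cost at least the distance by which they move a point. *)
Lemma l1_sum rs s : (forall r, 0 <= s r) ->
  l1 (\sum_(r <- rs) s r *: r) <= \sum_(r <- rs) l1 r * s r.
Proof.
move=> s0; elim: rs => [|r rs IH].
  by rewrite !big_nil /l1 big1 // => i _; rewrite mxE normr0.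
rewrite !big_cons; apply: le_trans (lerD (lexx _) IH).
rewrite /l1 mulr_suml -big_split /=; apply: ler_sum => i _.
by rewrite !mxE (le_trans (ler_normD _ _)) // normrM (ger0_norm (s0 r)) mulrC.
Qed.

Lemma Zn0 : Zn (0 : Rn).
Proof. by apply/mxOverP => i j; rewrite mxE rpred0. Qed.

Lemma ZnD v z : Zn v -> Zn z -> Zn (v + z).
Proof.
by move=> /mxOverP hv /mxOverP hz; apply/mxOverP => i j; rewrite mxE rpredD.
Qed.

Lemma ZnN v : Zn v -> Zn (- v).
Proof. by move=> /mxOverP hv; apply/mxOverP => i j; rewrite mxE rpredN. Qed.

Lemma ZnZ v (m : int) : Zn v -> Zn (m%:~R *: v).
Proof.
by move=> /mxOverP hv; apply/mxOverP => i j; rewrite mxE rpredM ?rpred_int.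
Qed.

(** One noninteger coordinate of [v] suffices: [d] is its distance to the nearest integer. *)
Lemma Zn_dist v : ~ Zn v ->
  exists d, 0 < d /\ forall z, Zn z -> d <= l1 (v + z).
Proof.
move=> nZ.
have [i vi] : exists i, v 0 i \isn't a Num.int.
  apply: contrapT => h; apply: nZ; apply/mxOverP => k j; rewrite (ord1 k).
  by apply: contrapT => vj; apply: h; exists j; exact/negP.
pose x := v 0 i; pose k := Num.floor x.
have kx : k%:~R < x.
  rewrite lt_neqAle Num.Theory.floor_le andbT; apply: contraNneq vi => kx.
  rewrite -/x -kx; exact: rpred_int.
have xk : x < (k + 1)%:~R by exact: floorD1_gt.
exists (Num.min (x - k%:~R) ((k + 1)%:~R - x)); split.
  by rewrite lt_min !subr_gt0 kx xk.
move=> z /mxOverP /(_ 0 i) /intrP[m zm].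
apply: (@le_trans _ _ `|x + m%:~R|); last first.
  by rewrite /l1 (bigD1 i) //= mxE zm lerDl sumr_ge0.
rewrite ge_min; have [mk|mk] := leP (- k) m.
  have : (- k)%:~R <= m%:~R :> R by rewrite ler_int.
  rewrite mulrNz => h; apply/orP; left.
  by apply: le_trans (ler_norm _); lra.
have : (m + 1)%:~R <= (- k)%:~R :> R by rewrite ler_int; lia.
rewrite mulrNz intrD => h; apply/orP; right.
by rewrite -normrN; apply: le_trans (ler_norm _); rewrite intrD; lra.
Qed.

Definition lattice ps : set funRn :=
  [set l | [/\ forall p, l p \is a Num.int, forall p, p \notin ps -> l p = 0
     & Zn (\sum_(p <- ps) l p *: p)]].

Lemma lattice0 ps : lattice ps 0.
Proof.
split=> [p|//|]; first by rewrite rpred0.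
by rewrite big1 => [|p _]; [exact: Zn0 | rewrite scale0r].
Qed.

Lemma lattice_int_closed ps : int_closed (lattice ps).
Proof.
move=> x y m k [xi x0 xZ] [yi y0 yZ]; split=> [p|p pps|].
- by rewrite !fctE; apply: rpredD; apply: rpredM; rewrite ?rpred_int.
- by rewrite !fctE x0 // y0 // !scaler0 addr0.
have -> : \sum_(p <- ps) (m%:~R *: x + k%:~R *: y) p *: p =
    m%:~R *: (\sum_(p <- ps) x p *: p) + k%:~R *: (\sum_(p <- ps) y p *: p).
  rewrite !scaler_sumr -big_split; apply: eq_bigr => p _ /=.
  by rewrite !fctE scalerDl !scalerA.
by apply: ZnD; exact: ZnZ.
Qed.

(** When nonempty, this is the nonnegative part of one coset of [lattice ps]. Summing over a list
    avoids finite-support side conditions. *)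
Definition lattice_points b ps : set funRn :=
  [set y | [/\ forall p, y p \is a Num.nat, forall p, p \notin ps -> y p = 0
     & Zn (\sum_(p <- ps) y p *: p - b)]].

Lemma I_V_E b ps : uniq ps -> I_ b `&` V_ [set` ps] = lattice_points b ps.
Proof.
move=> ups; have sum0 : \sum_(r \in [set: Rn]) (0 : funRn) r *: r = 0.
  by apply: fsbig1 => r _; rewrite scale0r.
apply/seteqP; split=> [y [[_ _ ynat /=] [z Zz bz]] [_ y0]|y [ynat y0 yZ]].
  have y0' p : p \notin ps -> y p = 0 by move=> /negP; exact: y0.
  split=> //; move: bz; rewrite sum0 add0r (fsum_seqT ups) => [<-|p /y0' ->].
    by rewrite addrC addKr.
  by rewrite scale0r.
have fy : fin_supp y by apply/fin_suppP; exists ps.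
split; last by split=> // p /negP; exact: y0.
split=> //=.
  split=> [|r]; last exact: lexx.
  by apply/fin_suppP; exists [::].
exists (\sum_(p <- ps) y p *: p - b) => //.
rewrite sum0 add0r (fsum_seqT ups) => [|p /y0 ->]; last by rewrite scale0r.
by rewrite addrC subrK.
Qed.

Lemma I_ge0 b y p : I_ b y -> 0 <= y p.
Proof. by move=> [_ _ ynat _]; rewrite natr_ge0. Qed.

(* Points of [I_ b] are nonnegative, so that [V_ P] is a face. *)
Lemma corner_polyhedronE b ps : uniq ps ->
  corner_polyhedron b [set` ps] = convex_hull (lattice_points b ps).
Proof.
move=> ups; rewrite -I_V_E //; apply/seteqP; split=> [y [hy Vy]|].
  (* The claim must be conditional, since points of [I_ b] may lie outside [V_]. Nonnegativity makes
     both ends of a segment vanish wherever an inner point does. *)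
  pose X : set funRn := [set x | (forall p, 0 <= x p) /\
    (V_ [set` ps] x -> convex_hull (I_ b `&` V_ [set` ps]) x)].
  have : X y.
    apply: convex_hull_sub hy => [u v t t0 t1 [u0 Xu] [v0 Xv]|u Iu].
      have t10 : 0 < 1 - t by rewrite subr_gt0.
      split=> [p|[_ Vx]].
        by apply: addr_ge0; apply: mulr_ge0 => //; exact: ltW.
      have uv p : p \notin ps -> u p = 0 /\ v p = 0.
        move=> /negP /Vx /eqP; rewrite !fctE /GRing.scale /= paddr_eq0;
          rewrite ?mulr_ge0 ?(ltW t0) ?(ltW t10) //.
        by rewrite !mulf_eq0 (gt_eqF t0) (gt_eqF t10) => /andP[/eqP -> /eqP ->].
      apply: convex_hull_conv; rewrite ?ltW //; [apply: Xu | apply: Xv];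
        split=> [|p /negP /uv[] //]; apply/fin_suppP; exists ps => p /uv[] //.
    by split=> [p|Vu]; [exact: I_ge0 Iu | exact: sub_convex_hull].
  by case=> _; exact.
apply: (@convex_hull_sub _ _ _ (corner_polyhedron b [set` ps]))
  => [u v t t0 t1 [hu [_ Vu]] [hv [_ Vv]]|u [Iu Vu]].
  split; first by apply: convex_hull_conv; rewrite ?ltW.
  have V0 p : ~ [set` ps] p -> (t *: u + (1 - t) *: v) p = 0.
    by move=> nps; rewrite !fctE Vu // Vv // !scaler0 addr0.
  by split=> //; apply/fin_suppP; exists ps => p /negP; exact: V0.
by split=> //; exact: sub_convex_hull.
Qed.

(** * Valid tuples obtained from positive functionals *)

Lemma seq_exists_pos (T : eqType) (F : seq T) (Q : T -> R -> Prop) :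
  (forall f d e, 0 < e -> e <= d -> Q f d -> Q f e) ->
  (forall f, f \in F -> exists d, 0 < d /\ Q f d) ->
  exists d, 0 < d /\ forall f, f \in F -> Q f d.
Proof.
move=> Qd; elim: F => [|f F IH] FQ; first by exists 1.
have [|d [d0 dF]] := IH; first by move=> g gF; apply: FQ; rewrite inE gF orbT.
have [|e [e0 eQ]] := FQ f; first by rewrite inE eqxx.
have m0 : 0 < Num.min d e by rewrite lt_min d0 e0.
exists (Num.min d e); split=> // g; rewrite inE => /orP[/eqP ->|/dF].
  by apply: Qd eQ; rewrite // ge_min lexx orbT.
by apply: Qd; rewrite // ge_min lexx.
Qed.

Lemma finite_bounded_nat ps (a : Rn -> R) (B : set funRn) :
  (forall y p, B y -> y p \is a Num.nat) ->
  (forall y p, B y -> p \notin ps -> y p = 0) ->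
  (forall y p, B y -> p \in ps -> y p <= a p) ->
  exists F : seq funRn, forall y, B y <-> y \in F.
Proof.
move=> Bnat B0 Ba.
(* Dickson's lemma applied to [y] and its complement: among the pairs
   [(y, a - y)], domination is equality. *)
pose u (p : Rn * bool) (y : funRn) : nat := if p.2 then Num.truncn (y p.1)
  else (Num.truncn (a p.1) - Num.truncn (y p.1))%N.
have [F [FB FP]] := dickson u (allpairs pair ps [:: true; false]) B.
exists F => y; split=> [By|/FB //].
have [f fF fP] := FP y By; suff -> : y = f by [].
apply/funext => p; have Bf := FB _ fF.
have [pps|pps] := boolP (p \in ps); last by rewrite (B0 _ _ By) ?(B0 _ _ Bf).
rewrite -(truncnK (Bnat _ p By)) -(truncnK (Bnat _ p Bf)); congr (_ %:R).
have h1 : (Num.truncn (f p) <= Num.truncn (y p))%N.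
  by apply: (fP (p, true)); apply/allpairsP; exists (p, true); rewrite !inE.
have : (Num.truncn (a p) - Num.truncn (f p) <=
        Num.truncn (a p) - Num.truncn (y p))%N.
  by apply: (fP (p, false)); apply/allpairsP; exists (p, false); rewrite !inE.
have := le_truncn (Ba _ _ By pps); lia.
Qed.

(** Three cases. A positive integer variable off [ps] contributes at least 1. If [y] lives on [ps],
    either its [a]-value is at least 1, or [y] is one of finitely many points missing the coset; the
    continuous variables then bridge a distance of at least [d], at a cost of at least 1. *)
Lemma valid_tuple_extension b ps (a : Rn -> R) : uniq ps ->
  (forall p, p \in ps -> 0 < a p) ->
  (forall y, lattice_points b ps y -> 1 <= \sum_(p <- ps) a p * y p) ->
  exists psi pi, valid_tuple b psi pi 1 /\ forall p, p \in ps -> pi p = a p.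
Proof.
move=> ups a0 aS.
pose B : set funRn := [set y | [/\ forall p, y p \is a Num.nat,
  forall p, p \notin ps -> y p = 0 & \sum_(p <- ps) a p * y p < 1]].
(* Each term [a p * y p] is below 1, whence the bound by the inverse of [a p]. *)
have [||| F FB] := @finite_bounded_nat ps (fun p => (a p)^-1) B.
- by move=> y p [].
- by move=> y p [_ + _]; exact.
- move=> y p [ynat y0 ya] pps.
  rewrite -[leRHS]mul1r ler_pdivlMr ?a0 // mulrC; apply: le_trans (ltW ya).
  rewrite (bigD1_seq p) //= lerDl big_seq_cond sumr_ge0 // => q /andP[qps _].
  by apply: mulr_ge0; [exact/ltW/a0 | exact/natr_ge0].
have [||d [d0 dF]] := @seq_exists_pos _ F (fun y d => forall z, Zn z ->
    d <= l1 (\sum_(p <- ps) y p *: p - b + z)).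
- by move=> f d e _ ed fd z /fd; exact: le_trans.
- move=> y /FB[ynat y0 ya]; apply: Zn_dist => yZ.
  have : 1 <= \sum_(p <- ps) a p * y p by apply: aS.
  by rewrite leNgt ya.
exists (fun r => l1 r / d), (fun p => if p \in ps then a p else 1).
split=> [|p ->] //; split; first by right.
case=> s y [[/= /fin_suppP[ss ss0] s0] /fin_suppP[ys ys0] ynat [z Zz bz]].
rewrite /satisfies /=.
pose rs := undup (ss ++ ys ++ ps).
have urs : uniq rs by exact: undup_uniq.
have rsP r : r \notin rs -> s r = 0 /\ y r = 0.
  by rewrite mem_undup !mem_cat !negb_or => /and3P[/ss0 -> /ys0 -> _].
have y_ge0 p : 0 <= y p by rewrite natr_ge0.
rewrite !(fsum_seqT urs) => [|r /rsP[_ ->]|r /rsP[-> _]]; rewrite ?mulr0 //.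
set A := \sum_(r <- rs) _; set C := \sum_(p <- rs) _.
have A0 : 0 <= A.
  apply: sumr_ge0 => r _; apply: mulr_ge0 => //.
  by rewrite divr_ge0 ?l1_ge0 // ltW.
have pi0 p : 0 <= (if p \in ps then a p else 1) * y p.
  by rewrite mulr_ge0 //; case: ifP => // /a0 /ltW.
have [[p [pps yp]]|yps] := pselect (exists p, p \notin ps /\ y p != 0).
  have pC : y p <= C.
    rewrite /C (bigD1_seq p) //=; last first.
      by apply: contraNT yp => /rsP[_ ->].
    by rewrite (negbTE pps) mul1r lerDl sumr_ge0.
  have : 1 <= y p.
    have /natrP[k yk] := ynat p; rewrite yk pnatr_eq0 in yp.
    by rewrite yk ler1n lt0n.
  by move=> h; rewrite (le_trans h) // (le_trans pC) // lerDr.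
have {}yps p : p \notin ps -> y p = 0.
  by move=> pps; apply: contra_notP yps => /eqP yp; exists p.
have sum_ps (V : nmodType) (f : Rn -> V) : (forall p, p \notin ps -> f p = 0) ->
    \sum_(p <- rs) f p = \sum_(p <- ps) f p.
  move=> f0; rewrite -(fsum_seqT urs) ?(fsum_seqT ups) // => r rrs.
  by apply: f0; apply: contraNN rrs; rewrite mem_undup !mem_cat => ->; rewrite !orbT.
have CE : C = \sum_(p <- ps) a p * y p.
  rewrite /C sum_ps => [|p /yps ->]; last by rewrite mulr0.
  by apply: eq_big_seq => p ->.
have [C1|C1] := leP 1 C; first by rewrite (le_trans C1) // lerDr.
have yF : y \in F by apply/FB; split; rewrite -?CE.
(* The gap from [y] to the lattice point [z] is closed by the continuous part alone, up to sign. *)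
have := dF y yF (- z) (ZnN Zz).
move: bz; rewrite !(fsum_seqT urs) => [bz|r /rsP[_ ->]|r /rsP[-> _]];
  rewrite ?scale0r //.
rewrite -sum_ps => [|p /yps ->]; last by rewrite scale0r.
have -> : \sum_(p <- rs) y p *: p - b - z = - \sum_(r <- rs) s r *: r.
  apply/eqP; rewrite -addrA -opprD bz opprD addrCA subrr addr0 //.
rewrite l1N => /le_trans /(_ (l1_sum rs s0)) h.
suff : 1 <= A by move=> h1; rewrite (le_trans h1) // lerDl sumr_ge0.
have -> : A = (\sum_(r <- rs) l1 r * s r) / d.
  by rewrite mulr_suml; apply: eq_bigr => r _; rewrite mulrAC.
by rewrite ler_pdivlMr // mul1r.
Qed.

End Lattice.

(** * Comparison of the corner polyhedron with the valid inequalities *)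

Theorem theorem5p2 (R : realType) (n : nat) (b : 'rV[R]_n)
    (hb : ~ Zn b) (P : set 'rV[R]_n) (hP : finite_set P) :
  corner_polyhedron b P = G_ b `&` affine_hull (corner_polyhedron b P).
Proof.
have /finite_seqP[ps0 P0] := hP.
pose ps := undup ps0; have ups : uniq ps by exact: undup_uniq.
have {P0} -> : P = [set` ps].
  by rewrite P0; apply/seteqP; split=> p; rewrite /= mem_undup.
pose S := lattice_points b ps.
apply/seteqP; split=> y.
  (* A point is an affine combination of itself; a valid inequality holds on [S], hence on its
     convex hull. *)
  move=> Cy; split; last first.
    exists 1%N, (fun=> 1), (fun=> y); split=> //.
      by rewrite big_ord1.
    by rewrite big_ord1 scale1r.
  have hull_ge0 : convex_hull S `<=` [set x | forall p, 0 <= x p].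
    apply: convex_hull_sub => [u v t t0 t1 u0 v0 p|u [unat _ _] p].
      by apply: addr_ge0; apply: mulr_ge0; rewrite ?subr_ge0 ?(ltW t0) ?(ltW t1).
    by rewrite natr_ge0.
  have [_ [fy y0]] := Cy.
  rewrite corner_polyhedronE // in Cy.
  split=> //; split=> /= [||psi pi alpha [_ valid]].
  - by split=> [|p]; [apply/fin_suppP; exists [::] | exact: lexx].
  - by split=> //; exact: hull_ge0.
  have sum_ps (x : 'rV[R]_n -> R^o) : (forall p, p \notin ps -> x p = 0) ->
      satisfies psi pi alpha (0, x) <-> alpha <= \sum_(p <- ps) pi p * x p.
    move=> x0; rewrite /satisfies /= fsbig1 => [|p _]; last by rewrite mulr0.
    by rewrite add0r (fsum_seqT ups) // => p /x0 ->; rewrite mulr0.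
  apply/sum_ps => [p /negP|]; first exact: y0.
  move: y Cy {fy y0}; apply: convex_hull_sub => [u v t t0 t1 au av|u Su] /=.
    have -> : \sum_(p <- ps) pi p * (t *: u + (1 - t) *: v) p =
        t * (\sum_(p <- ps) pi p * u p) + (1 - t) * (\sum_(p <- ps) pi p * v p).
      rewrite !mulr_sumr -big_split; apply: eq_bigr => p _ /=.
      by rewrite !fctE /GRing.scale /=; ring.
    have -> : alpha = t * alpha + (1 - t) * alpha by ring.
    by apply: lerD; rewrite ler_pM2l // subr_gt0.
  have [_ u0 _] := Su; apply/sum_ps => //; apply: valid.
  by move: Su; rewrite /S -I_V_E // => -[].
case=> -[fy [_ [_ y_ge0] yQ]] Ay.
rewrite /= in y_ge0.
(* If [S] is empty, so is its hull; an affine combination could then have no terms, but its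
   coefficients would sum to 0. *)
have [[s0 Ss0]|nS] := pselect (exists s0, S s0); last first.
  have hull0 x : ~ convex_hull S x.
    apply: (@convex_hull_sub _ _ _ set0) => // u Su.
    by case: nS; exists u.
  case: Ay => -[|m] [c [a [Ca c1 _]]].
    by move: c1; rewrite big_ord0 => /esym/eqP; rewrite oner_eq0.
  by have := Ca ord0; rewrite corner_polyhedronE // => /hull0.
have SL s s' : S s -> S s' -> lattice ps (s - s').
  move=> [snat sv sZ] [snat' sv' sZ']; split=> [p|p pps|].
  - by rewrite !fctE; apply: rpredB; exact: intr_nat.
  - by rewrite !fctE sv // sv' // subrr.
  have -> : \sum_(p <- ps) (s - s') p *: p = (\sum_(p <- ps) s p *: p - b) +
      - (\sum_(p <- ps) s' p *: p - b).
    rewrite opprB addrA subrK -sumrB; apply: eq_bigr => p _.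
    by rewrite !fctE scalerBl.
  by apply: ZnD => //; exact: ZnN.
have hullL x : convex_hull S x -> real_span (lattice ps) (x - s0).
  by apply: convex_hull_real_span => s Ss; exact: SL.
have Ly : real_span (lattice ps) (y - s0).
  apply: affine_hull_real_span Ay => s; rewrite corner_polyhedronE //.
  exact: hullL.
(* Lying in the affine hull confines [y] to the coordinates in [ps]. *)
have y0 p : p \notin ps -> y p = 0.
  move=> pps; have : (y - s0) p = 0.
    elim: Ly => [//|c l v [_ l0 _] _ v0].
    by rewrite !fctE l0 // v0 scaler0 addr0.
  by have [_ sv _] := Ss0; rewrite !fctE sv // subr0.
rewrite corner_polyhedronE //.
have [F [FS FP]] := dickson (fun p f => Num.truncn (f p)) ps S.
(* Either [y] is reached from the hull by adding a nonnegative vector of the span, or a positive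
   functional cuts it off from [F]. *)
have [[g hg gy]|[a [a0 aF]]] := dominated_or_separated F y ups.
  have {}hg : convex_hull S g.
    move: g hg {gy}; apply: convex_hull_sub => [u v t t0 t1 hu hv|u /FS Su].
      by apply: convex_hull_conv => //; exact: ltW.
    exact: sub_convex_hull.
  have g0 p : p \notin ps -> g p = 0.
    move=> pps; have : (g - s0) p = 0.
      elim: (hullL _ hg) => [//|c l v [_ l0 _] _ v0].
      by rewrite !fctE l0 // v0 scaler0 addr0.
    by have [_ sv _] := Ss0; rewrite !fctE sv // subr0.
  apply: (convex_hull_lattice_up (L := lattice ps) (g := g) (ps := ps)) => //.
  - exact: lattice_int_closed.
  - exact: lattice0.
  - by move=> l p [].
  - by move=> l p [_ + _]; exact.
  - move=> s l [snat sv sZ] [li lv lZ] l_ge0; split=> [p|p pps|].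
    + by rewrite !fctE; apply: rpredD => //; rewrite natrEint li l_ge0.
    + by rewrite !fctE sv // lv // addr0.
    have -> : \sum_(p <- ps) (s + l) p *: p - b =
        (\sum_(p <- ps) s p *: p - b) + \sum_(p <- ps) l p *: p.
      rewrite addrAC -big_split; congr (_ - b); apply: eq_bigr => p _.
      by rewrite !fctE scalerDl.
    exact: ZnD.
  - have -> : y - g = (y - s0) + (-1) *: (g - s0).
      by rewrite scaleN1r opprB addrA subrK.
    by apply: real_spanD => //; apply: real_spanZ; exact: hullL.
  - move=> p; have [/gy //|pps] := boolP (p \in ps).
    by rewrite g0 // y0.
(* Dividing [a] by its minimum [m] over [F] gives value at least 1 on [S], each point of which
   dominates a member of [F], and value below 1 at [y]. The extended valid tuple then contradicts
   [yQ]. *)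
pose val (x : 'rV[R]_n -> R^o) := \sum_(p <- ps) a p * x p.
have [/(congr1 size)|[m /mapP[f fF mf] mP]] := seq_minP (map val F).
  have [f fF _] := FP _ Ss0.
  by rewrite size_map => /size0nil F0; rewrite F0 in fF.
have ym : val y < m by rewrite mf; exact: aF.
have m0 : 0 < m.
  apply: le_lt_trans ym; rewrite /val big_seq_cond sumr_ge0 // => p /andP[pps _].
  by apply: mulr_ge0 => //; exact/ltW/a0.
have valM x : \sum_(p <- ps) (a p / m) * x p = val x / m.
  by rewrite /val mulr_suml; apply: eq_bigr => p _; rewrite mulrAC.
have [||psi [pi [valid piE]]] :=
    @valid_tuple_extension _ _ b ps (fun p => a p / m) ups.
- by move=> p pps; rewrite divr_gt0 ?a0.
- move=> x Sx; rewrite valM ler_pdivlMr // mul1r.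
  have [h hF hx] := FP x Sx.
  apply: le_trans (mP _ (map_f val hF)) _.
  rewrite /val big_seq_cond [leRHS]big_seq_cond; apply: ler_sum => p /andP[pps _].
  have [xnat _ _] := Sx; have [hnat _ _] := FS _ hF.
  rewrite ler_pM2l ?a0 // -(truncnK (xnat p)) -(truncnK (hnat p)) ler_nat.
  exact: hx.
have := yQ psi pi 1 valid.
rewrite /satisfies /= fsbig1 => [|p _]; last by rewrite mulr0.
rewrite add0r (fsum_seqT ups) => [|p /y0 ->]; last by rewrite mulr0.
rewrite (_ : \sum_(p <- ps) pi p * y p = val y / m); last first.
  by rewrite -valM; apply: eq_big_seq => p /piE ->.
by rewrite ler_pdivlMr // mul1r leNgt ym.
Qed.
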